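(* Let $N\ge 0$ be an integer, $0<\nu<1$, $0<\alpha<1$, and let $\mathbf{\Phi}(x)=[\widetilde{C}_{N,0,\nu}(x),\dots,\widetilde{C}_{N,N,\nu}(x)]^{T}$ be the vector of fractional Chelyshkov polynomials. Let $\mathcal{P}=(\Theta(n,k))_{n,k=0}^{N}$ be the $(N+1)\times(N+1)$ matrix with entries $$\Theta(n,k)=\sum_{j=n}^{N}(-1)^{j-n}\binom{N-n}{j-n}\binom{N+j+1}{N-n}\,B(\alpha,j\nu+1)\,\xi_{k,j},$$ where $B(\cdot,\cdot)$ is the Beta function and $$\xi_{k,j}=\nu(2k+1)\sum_{l=k}^{N}\frac{(-1)^{l-k}}{(j+l+1)\nu+\alpha}\binom{N-k}{l-k}\binom{N+l+1}{N-k}.$$ Then $$\int_{0}^{x}(x-s)^{\alpha-1}\mathbf{\Phi}(s)\,ds\simeq\mathcal{P}\,\mathbf{\Phi}(x),$$ where $\simeq$ means that, for each $n=0,\dots,N$, the $n$-th component $\sum_{k=0}^{N}\Theta(n,k)\widetilde{C}_{N,k,\nu}$ of the right-hand side is the best approximation from $M_N$, in the weighted norm $\|\cdot\|_2$, of the $n$-th component $x\mapsto\int_0^x(x-s)^{\alpha-1}\widetilde{C}_{N,n,\nu}(s)\,ds$ of the left-hand side.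
   Context: The fractional Chelyshkov polynomials are $\widetilde{C}_{N,n,\nu}(x)=\sum_{j=n}^{N}(-1)^{j-n}\binom{N-n}{j-n}\binom{N+j+1}{N-n}x^{j\nu}$ for $n=0,\dots,N$ and $x\in[0,1]$. Let $\varpi(x)=x^{\nu-1}$. $L^2(\Omega)$, with $\Omega=[0,1]$, is the weighted Hilbert space of functions $u:\Omega\to\mathbb{R}$ with $\int_0^1|u(x)|^2\varpi(x)\,dx<\infty$, with inner product $\langle u,v\rangle=\int_0^1 u(x)v(x)\varpi(x)\,dx$ and norm $\|u\|_2=\langle u,u\rangle^{1/2}$. $M_N=\mathrm{Span}\{\widetilde{C}_{N,0,\nu},\dots,\widetilde{C}_{N,N,\nu}\}$. The best approximation of $u\in L^2(\Omega)$ from $M_N$ is the unique $\widehat{u}_N\in M_N$ with $\|u-\widehat{u}_N\|_2\le\|u-v\|_2$ for all $v\in M_N$. *)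

(* Defs.v *)
From HB Require Import structures.
From mathcomp Require Export all_boot all_order all_algebra.
From mathcomp Require Export all_classical all_reals all_analysis.

Set Implicit Arguments.
Unset Strict Implicit.
Unset Printing Implicit Defensive.

Import Order.TTheory GRing.Theory Num.Theory.

Local Open Scope classical_set_scope.
Local Open Scope ring_scope.

(* Functions on [0, 1] are total functions R -> R of which only the values on
   [0, 1] matter.  MathComp-Analysis has 0 `^ 0 = 1 and 0 `^ a = 0 for a != 0,
   so x `^ (j%:R * nu) is right at x = 0 (also for j = 0), while the values
   that the singular weights and kernels receive at their singularity are
   irrelevant to the Lebesgue integrals below. *)

Definition chelyshkov (R : realType) (N : nat) (nu : R) (n : nat) (x : R) : R :=
  \sum_(n <= j < N.+1)
    (-1) ^+ (j - n) * 'C(N - n, j - n)%:R * 'C(N + j + 1, N - n)%:R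
      * x `^ (j%:R * nu).

Definition chelyshkov_vec (R : realType) (N : nat) (nu x : R) : 'cV[R]_N.+1 :=
  \col_(n < N.+1) chelyshkov N nu n x.

Definition weight (R : realType) (nu x : R) : R := x `^ (nu - 1).

Definition inL2 (R : realType) (nu : R) (u : R -> R) : Prop :=
  measurable_fun (`[0, 1]%classic : set R) u /\
  (\int[lebesgue_measure]_(x in `[0%R, 1%R])
     (`|u x| ^+ 2 * weight nu x)%:E < +oo)%E.

Definition innerL2 (R : realType) (nu : R) (u v : R -> R) : R :=
  \int[lebesgue_measure]_(x in `[0, 1]) (u x * v x * weight nu x).

Definition normL2 (R : realType) (nu : R) (u : R -> R) : R :=
  Num.sqrt (innerL2 nu u u).

Definition inM (R : realType) (N : nat) (nu : R) (v : R -> R) : Prop :=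
  exists c : 'I_N.+1 -> R, forall x, 0 <= x <= 1 ->
    v x = \sum_(k < N.+1) c k * chelyshkov N nu k x.

Definition is_minimizer (R : realType) (N : nat) (nu : R) (u w : R -> R) : Prop :=
  inM N nu w /\
  forall v : R -> R, inM N nu v -> normL2 nu (u \- w) <= normL2 nu (u \- v).

Definition best_approx (R : realType) (N : nat) (nu : R) (u w : R -> R) : Prop :=
  [/\ inL2 nu u,
      is_minimizer N nu u w &
      forall w' : R -> R, is_minimizer N nu u w' ->
        forall x, 0 <= x <= 1 -> w' x = w x].

(* The library's [beta_fun] only takes natural number arguments. *)
Definition Beta (R : realType) (a b : R) : R :=
  \int[lebesgue_measure]_(t in `[0, 1]) (t `^ (a - 1) * (1 - t) `^ (b - 1)).

Definition xi (R : realType) (N : nat) (nu alpha : R) (k j : nat) : R :=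
  nu * (2 * k + 1)%:R *
  \sum_(k <= l < N.+1)
    (-1) ^+ (l - k) / ((j + l + 1)%:R * nu + alpha)
      * 'C(N - k, l - k)%:R * 'C(N + l + 1, N - k)%:R.

Definition Theta (R : realType) (N : nat) (nu alpha : R) (n k : nat) : R :=
  \sum_(n <= j < N.+1)
    (-1) ^+ (j - n) * 'C(N - n, j - n)%:R * 'C(N + j + 1, N - n)%:R
      * Beta alpha (j%:R * nu + 1) * xi N nu alpha k j.

Definition op_matrix (R : realType) (N : nat) (nu alpha : R) : 'M[R]_N.+1 :=
  \matrix_(n < N.+1, k < N.+1) Theta N nu alpha n k.

Definition abel_integral_vec (R : realType) (m : nat) (alpha : R)
    (F : R -> 'cV[R]_m) (x : R) : 'cV[R]_m :=
  \col_(n < m)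
    \int[lebesgue_measure]_(s in `[0, x]) ((x - s) `^ (alpha - 1) * F s n ord0).

(* Main.v *)
Require Import Defs.
From mathcomp Require Import measurable_realfun zify ring lra.

Set Implicit Arguments.
Unset Strict Implicit.
Unset Printing Implicit Defensive.

Import Order.TTheory GRing.Theory Num.Theory.
Import numFieldNormedType.Exports.
Local Open Scope classical_set_scope.
Local Open Scope ring_scope.

(* The substitution s = x (1 - t) turns the Abel integral of s^b into
   B(a, b + 1) x^(a + b), so the left-hand side is an explicit combination of
   powers.  For the weight x^(nu - 1) one has <x^a, x^b> = 1 / (a + b + nu), and
   the C_k are orthogonal with <C_k, C_k> = 1 / (nu (2k + 1)); hence Theta(n, k)
   is the Fourier coefficient of the left-hand side on C_k, and Pythagoras gives
   the best approximation and its uniqueness.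
   Orthogonality is a partial fraction computation:
   sum_i (-1)^i C(p, i) Q(i) / (i + z) = Q(-z) p! / (z (z + 1) ... (z + p)) when
   deg Q <= p.  The coefficients of C_k have this shape with Q vanishing at -z
   for the z's coming from x^(m nu), k < m <= N. *)

(** * Lebesgue integrals of powers *)

(** Lebesgue measure is determined by its values on the intervals []a, b]], so it suffices to
    compare it there with the pushforward along [t -> x - x * t], scaled by [x]. *)
Lemma lebesgue_measure_affine (R : realType) (x : R) (A : set R) : 0 < x -> measurable A ->
  (lebesgue_measure A = x%:E * lebesgue_measure ((fun t : R => (x - x * t)%R) @^-1` A))%E.
Proof.
move=> x0 mA.
pose phi (t : measurableTypeR R) : measurableTypeR R := x - x * t.
have mphi : measurable_fun [set: measurableTypeR R] phi.
  by apply: measurable_funB => //; exact: measurable_funM.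
pose c : {nonneg R} := NngNum (ltW x0).
apply: (@lebesgue_measure_unique R (mscale c (pushforward lebesgue_measure phi))) => //.
move=> _ [[a b]] _ <-.
rewrite -[RHS]/(x%:E * lebesgue_measure (phi @^-1` `]a, b]%classic))%E.
(* The map is decreasing, so the preimage is closed on the left and open on the right. *)
rewrite (_ : _ @^-1` _ = `[1 - b / x, 1 - a / x[%classic); last first.
  apply/seteqP; split => t /=; rewrite !in_itv/= /phi.
    rewrite -subr_gt0 -[X in _ && X]subr_ge0.
    rewrite (_ : x - x * t - a = (1 - a/x - t) * x); last by field; lra.
    rewrite (_ : b - (x - x * t) = (t - (1 - b/x)) * x); last by field; lra.
    by rewrite pmulr_lgt0// pmulr_lge0// subr_gt0 subr_ge0 andbC.
  rewrite -subr_ge0 -[X in _ && X]subr_gt0 => ?.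
  rewrite -subr_gt0 -[X in _ && X]subr_ge0.
  rewrite (_ : x - x * t - a = (1 - a/x - t) * x); last by field; lra.
  rewrite (_ : b - (x - x * t) = (t - (1 - b/x)) * x); last by field; lra.
  by rewrite pmulr_lgt0// pmulr_lge0// andbC.
rewrite !lebesgue_measure_itv/= !lte_fin.
rewrite (_ : (1 - b/x < 1 - a/x) = (a < b)); last by rewrite ltrD2l ltrN2 ltr_pM2r// invr_gt0.
case: ifPn => _; last by rewrite mule0.
rewrite -EFinB -EFinM; congr (_%:E).
by field; lra.
Qed.

Lemma ge0_integral_affine (R : realType) (x : R) (f : R -> R) : 0 < x ->
  measurable_fun `[0, x] f -> (forall s, 0 <= f s) ->
  (\int[lebesgue_measure]_(s in `[0%R, x]) (f s)%:E =
   x%:E * \int[lebesgue_measure]_(t in `[0%R, 1%R]) (f (x - x * t)%R)%:E)%E.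
Proof.
move=> x0 mf f0.
pose phi (t : measurableTypeR R) : measurableTypeR R := x - x * t.
have mphi : measurable_fun [set: measurableTypeR R] phi.
  by apply: measurable_funB => //; exact: measurable_funM.
pose c : {nonneg R} := NngNum (ltW x0).
rewrite (@eq_measure_integral _ _ _ _ (mscale c (pushforward lebesgue_measure phi)));
  last first.
  by move=> A mA _; exact: lebesgue_measure_affine.
have mEf : measurable_fun (`[0, x]%classic : set (measurableTypeR R))
    (fun s : measurableTypeR R => (f s)%:E).
  exact/measurable_EFinP.
rewrite ge0_integral_mscale//; last by move=> *; rewrite lee_fin.
rewrite ge0_integral_pushforward//; last by move=> *; rewrite lee_fin.
congr (_ * _)%E.
rewrite (_ : _ @^-1` _ = `[0, 1]%classic)//.
apply/seteqP; split => t /=; rewrite !in_itv/= /phi.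
  by move=> /andP[h1 h2]; apply/andP; split; nra.
by move=> /andP[h1 h2]; apply/andP; split; nra.
Qed.

Lemma integral_powR (R : realType) (a b c : R) : a != 0 -> 0 < b -> b <= c ->
  (\int[lebesgue_measure]_(t in `[b, c]) (t `^ (a - 1))%:E =
     (a^-1 * c `^ a - a^-1 * b `^ a)%:E)%E.
Proof.
move=> a0 b0; rewrite le_eqVlt => /predU1P[<-|bc].
  by rewrite set_itv1 integral_set1 subrr.
have der (x p : R) : b <= x -> derivable (@powR R ^~ p) x 1.
  by move=> bx; apply: derivable_powR; rewrite in_itv/= andbT (lt_le_trans b0).
rewrite (@continuous_FTC2 _ _ (a^-1 \*: (@powR R ^~ a)))//.
- apply: derivable_within_continuous => x; rewrite in_itv/= => /andP[bx _].
  exact: der.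
- have cF x : b <= x -> {for x, continuous (a^-1 \*: (@powR R ^~ a))}.
    by move=> bx; apply/differentiable_continuous/derivable1_diffP/derivableZ; exact: der.
  split.
  + by move=> x; rewrite in_itv/= => /andP[bx _]; apply/derivableZ/der/ltW.
  + by apply: cvg_at_right_filter; exact: cF.
  + by apply: cvg_at_left_filter; apply: cF; exact: ltW.
- move=> x; rewrite in_itv/= => /andP[bx _].
  rewrite derive1E deriveZ/=; last exact/der/ltW.
  rewrite -derive1E powR_derive1; last by rewrite in_itv/= andbT (lt_trans b0).
  by rewrite /= /GRing.scale/= mulrA mulVf// mul1r.
Qed.

(** The integrand may blow up at 0: []0, 1]] is exhausted by the intervals [[1/(n+1), 1]], where the
    fundamental theorem of calculus applies, and monotone convergence gives the limit. *)
Lemma integral_powR01 (R : realType) (a : R) : 0 < a ->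
  (\int[lebesgue_measure]_(t in `[0%R, 1%R]) (t `^ (a - 1))%:E = (a^-1)%:E)%E.
Proof.
move=> a0.
have mp (D : set R) : measurable D -> measurable_fun D (fun t : R => (t `^ (a - 1))%:E).
  by move=> mD; apply/measurable_EFinP; apply: measurable_funTS; exact: measurable_powR.
rewrite -integral_itv_obnd_cbnd//; last exact: mp.
have -> : `]0:R, 1]%classic = \bigcup_n `[n.+1%:R^-1 : R, 1]%classic.
  by rewrite itv_open_bnd_bigcup; apply: eq_bigcupr => n _; rewrite add0r.
have := @ge0_nondecreasing_set_cvg_integral _ (measurableTypeR R) R
   (fun n => `[n.+1%:R^-1 : R, 1]%classic)
   (fun t : R => (t `^ (a - 1))%:E) (@lebesgue_measure R).
move=> /(_ _ _ _ _)/cvg_lim <- //; last 3 first.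
- move=> m n mn; apply/subsetPset => t /=; rewrite !in_itv/= => /andP[h ->].
  by rewrite andbT (le_trans _ h)// lef_pV2 ?posrE// ler_nat.
- by move=> *; exact: mp.
- by move=> *; rewrite lee_fin powR_ge0.
apply/cvg_lim => //.
rewrite (_ : (fun _ => _) = (fun n : nat => (a^-1 - a^-1 * (n.+1%:R^-1)`^a)%:E)); last first.
  apply/funext => n; rewrite integral_powR ?gt_eqF//.
    by rewrite powR1 mulr1.
  by rewrite invf_le1// ler1n.
apply/cvg_EFin; first by near=> n.
rewrite -[X in _ --> X]subr0 -[X in _ --> _ - X](mulr0 a^-1).
apply: cvgB; first exact: cvg_cst.
apply: cvgM; first exact: cvg_cst.
apply: ((cvg_at_rightP (@powR R ^~ a) 0 0).1 (powR_cvg0 a0)).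
by split; [move=> n; rewrite invr_gt0 | exact: cvg_harmonic].
Unshelve. all: by end_near. Qed.

(** * Alternating binomial sums *)

(** Pascal's rule: a difference of order [p.+1] is a difference of order [p] of first
    differences. *)
Lemma alt_bin_sumS (F : pzRingType) p (f : nat -> F) :
  \sum_(i < p.+2) (-1) ^+ i * 'C(p.+1, i)%:R * f i =
  \sum_(i < p.+1) (-1) ^+ i * 'C(p, i)%:R * (f i - f i.+1).
Proof.
under [RHS]eq_bigr do rewrite mulrBr.
rewrite sumrB big_ord_recl bin0/=.
rewrite [X in _ = X - _]big_ord_recl bin0 -addrA; congr (_ + _).
(* The added last term is zero because ['C(p, p.+1) = 0]. *)
rewrite [X in _ = X - _](_ : _ = \sum_(i < p.+1) (-1) ^+ i.+1 * 'C(p, i.+1)%:R * f i.+1); last first.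
  by rewrite [RHS]big_ord_recr/= bin_small//= mulr0 mul0r addr0; apply: eq_bigr.
rewrite -sumrB; apply: eq_bigr => i _.
by rewrite binS natrD /= exprS !mulrDr mulrDl -!mulrA !mulN1r.
Qed.

(** Differences of order [p] kill polynomials of degree less than [p]; here the polynomial is given
    by its linear factors. *)
Lemma alt_bin_sum_prod0 (F : comPzRingType) (s : seq F) p : (size s < p)%N ->
  \sum_(i < p.+1) (-1) ^+ i * 'C(p, i)%:R * \prod_(r <- s) (i%:R + r) = 0.
Proof.
(* Induction on the length, not on the list: the hypothesis is also needed for a list with shifted
   entries. *)
have [n] := ubnP (size s); elim: n s p => // n IH [|r s] [|p]//= sn sp.
  under eq_bigr do rewrite big_nil.
  by rewrite (alt_bin_sumS _ (fun=> 1)) big1 // => i _; rewrite subrr mulr0.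
(* The factor [i + r] is split. Its part [i] is absorbed by [i * C(p+1, i) = (p+1) * C(p, i-1)], and
   reindexing shifts the remaining factors by 1. *)
have -> : \sum_(i < p.+2) (-1) ^+ i * 'C(p.+1, i)%:R * \prod_(t <- r :: s) (i%:R + t) =
   r * (\sum_(i < p.+2) (-1) ^+ i * 'C(p.+1, i)%:R * \prod_(t <- s) (i%:R + t))
   - p.+1%:R * (\sum_(i < p.+1) (-1) ^+ i * 'C(p, i)%:R *
        \prod_(t <- map (+%R 1) s) (i%:R + t)).
  rewrite !mulr_sumr [X in _ = _ - X](_ : _ =
    - \sum_(i < p.+2) (-1) ^+ i * 'C(p.+1, i)%:R * (i%:R * \prod_(t <- s) (i%:R + t))).
    rewrite opprK -big_split/=; apply: eq_bigr => i _.
    by rewrite big_cons; ring.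
  rewrite [X in _ = - X]big_ord_recl mul0r mulr0 add0r -sumrN; apply: eq_bigr => i _.
  rewrite big_map/= exprS.
  have -> : \prod_(t <- s) (i%:R + (1 + t)) = \prod_(t <- s) (i.+1%:R + t).
    by apply: eq_bigr => t _; rewrite -natr1 addrA.
  have := congr1 (fun n => n%:R : F) (mul_bin_diag p.+1 i); rewrite !natrM /= => E.
  rewrite /bump/= add1n -[in LHS]mulrA mulrCA (mulrA p.+1%:R) E; ring.
by rewrite !IH ?size_map ?mulr0 ?subr0//; lia.
Qed.

Lemma alt_bin_sum_inv (F : numFieldType) p (z : F) : 0 < z ->
  \sum_(i < p.+1) (-1) ^+ i * 'C(p, i)%:R * (i%:R + z)^-1 =
  p`!%:R / \prod_(i < p.+1) (z + i%:R).
Proof.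
elim: p z => [|p IH] z z0.
  by rewrite !big_ord1 /= bin0 !mul1r add0r addr0.
rewrite (alt_bin_sumS _ (fun i => (i%:R + z)^-1)).
(* Since [(i + 1) + z = i + (1 + z)], the two sums are the induction hypothesis at [z] and at
   [1 + z]. *)
under eq_bigr do rewrite mulrBr -natr1 -addrA.
rewrite sumrB !IH//; last by rewrite addr_gt0.
rewrite big_ord_recl addr0 [\prod_(i < p.+1) (1 + z + i%:R)]big_ord_recr.
rewrite [\prod_(i < p.+2) _]big_ord_recl [\prod_(i < p.+1) _]big_ord_recr/=.
rewrite (_ : \prod_(i < p) (z + (bump 0 i)%:R) = \prod_(i < p) (1 + z + i%:R)); last first.
  by apply: eq_bigr => i _; rewrite /bump/= natrD; ring.
rewrite /bump/= add1n factS natrM addr0 -natr1.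
have : \prod_(i < p) (1 + z + i%:R) != 0.
  by apply/prodf_neq0 => i _; rewrite gt_eqF// ltr_wpDr// addr_gt0.
move: (\prod_(i < p) _) => P P0.
have zp : 1 + z + p%:R != 0 by rewrite gt_eqF// ltr_wpDr// addr_gt0.
have zp' : z + (p%:R + 1) != 0 by rewrite (_ : _ + _ = 1 + z + p%:R)//; ring.
by field; rewrite P0 zp' gt_eqF.
Qed.

(** Write [i + r = (i + z) + (r - z)]: the first part cancels the denominator and leaves a product
    of degree less than [p], which sums to 0; the second pulls out the constant [r - z]. *)
Lemma alt_bin_sum_frac (F : numFieldType) (s : seq F) p (z : F) : 0 < z -> (size s <= p)%N ->
  \sum_(i < p.+1) (-1) ^+ i * 'C(p, i)%:R * ((\prod_(r <- s) (i%:R + r)) / (i%:R + z)) =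
  (\prod_(r <- s) (r - z)) * p`!%:R / \prod_(i < p.+1) (z + i%:R).
Proof.
move=> z0; elim: s => [|r s IH] sp.
  rewrite big_nil mul1r -alt_bin_sum_inv//; apply: eq_bigr => i _.
  by rewrite big_nil mul1r.
rewrite big_cons -[X in X / _]mulrA -[RHS]mulrA -IH ?(ltnW sp)// mulr_sumr.
rewrite -[RHS]add0r -[X in _ = X + _](alt_bin_sum_prod0 sp) -big_split; apply: eq_bigr => i _ /=.
by rewrite big_cons; field; rewrite gt_eqF// ltr_wpDl.
Qed.

(** * Chelyshkov coefficients: moments and orthogonality *)

Lemma ffactD_prod a p : ((a + p) ^_ p = \prod_(j < p) (a + 1 + j))%N.
Proof.
elim: p => [|p IH]; first by rewrite ffactn0 big_ord0.
by rewrite addnS ffactSS IH big_ord_recr/= mulnC; congr (_ * _)%N; lia.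
Qed.

(** Up to a factorial, the second binomial of a coefficient is a polynomial in [i] of degree
    [N - k], the largest degree that [alt_bin_sum_frac] admits for [p = N - k]. *)
Lemma bin_chelyshkov_prod (F : comPzRingType) N k i : (k <= N)%N ->
  'C(N + (k + i) + 1, N - k)%:R * (N - k)`!%:R =
  \prod_(r <- [seq (2 * k + 2 + j)%:R | j <- iota 0 (N - k)]) (i%:R + r) :> F.
Proof.
move=> kN; rewrite big_map -[X in iota _ X]subn0 big_mkord -natrM bin_ffact.
rewrite (_ : (N + (k + i) + 1 = 2 * k + i + 1 + (N - k))%N); last by lia.
rewrite ffactD_prod natr_prod; apply: eq_bigr => j _.
by rewrite -natrD; congr (_%:R); lia.
Qed.

(** Meant for [n <= j] only: truncated subtraction does not make it vanish below [n], so sums over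
    [j] start at [n]. *)
Definition chelyshkov_coef (F : pzRingType) (N n j : nat) : F :=
  (-1) ^+ (j - n) * 'C(N - n, j - n)%:R * 'C(N + j + 1, N - n)%:R.

(** This is [nu] times the inner product of [x^(m nu)] with the [k]-th polynomial. With [l = k + i]
    it is a partial fraction sum at [z = k + m + 1], and [r - z] becomes [k + j + 1 - m]. *)
Lemma sum_chelyshkov_coef (F : numFieldType) N k m : (k <= N)%N ->
  \sum_(k <= l < N.+1) chelyshkov_coef F N k l / (m + l + 1)%:R =
  (\prod_(j < N - k) ((k + j + 1)%:R - m%:R)) /
     \prod_(i < (N - k).+1) (k + m + 1 + i)%:R.
Proof.
move=> kN.
have fact0 : (N - k)`!%:R != 0 :> F by rewrite pnatr_eq0 -lt0n fact_gt0.
set s := [seq (2 * k + 2 + j)%:R : F | j <- iota 0 (N - k)].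
have z0 : 0 < (k + m + 1)%:R :> F by rewrite ltr0n; lia.
have sz : (size s <= N - k)%N by rewrite size_map size_iota.
rewrite -{1}[k]add0n big_addn (_ : (N.+1 - k = (N - k).+1)%N); last by lia.
rewrite big_mkord.
transitivity ((N - k)`!%:R^-1 * \sum_(i < (N - k).+1) (-1) ^+ i * 'C(N - k, i)%:R *
    (\prod_(r <- s) (i%:R + r) / (i%:R + (k + m + 1)%:R)) : F).
  rewrite mulr_sumr; apply: eq_bigr => i _.
  rewrite /chelyshkov_coef addnK (addnC i k) -bin_chelyshkov_prod//.
  rewrite (_ : (m + (k + i) + 1 = i + (k + m + 1))%N); last by lia.
  by rewrite natrD; field; rewrite fact0 andbT -[1]/(1%:R) -!natrD pnatr_eq0 !addnS.
rewrite alt_bin_sum_frac// mulrA mulrCA mulVf// mulr1; congr (_ / _).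
  rewrite /s big_map -[X in iota _ X]subn0 big_mkord; apply: eq_bigr => j _.
  by rewrite !natrD; ring.
by apply: eq_bigr => i _; rewrite -natrD.
Qed.

Lemma chelyshkov_coef_orthogonal (F : numFieldType) N k n : (k <= n <= N)%N ->
  \sum_(n <= m < N.+1) \sum_(k <= l < N.+1)
    chelyshkov_coef F N n m * chelyshkov_coef F N k l / (m + l + 1)%:R =
  (n == k)%:R / (2 * k + 1)%:R.
Proof.
move=> /andP[kn nN].
have kN : (k <= N)%N := leq_trans kn nN.
under eq_bigr => m _.
  under eq_bigr do rewrite -mulrA.
  rewrite -mulr_sumr sum_chelyshkov_coef//.
  over.
(* The factor at [j = m - k - 1] is zero, so only [m = k] can contribute to the double sum. *)
have vanish m : (k < m)%N -> (m <= N)%N ->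
    \prod_(j < N - k) ((k + j + 1)%:R - m%:R) = 0 :> F.
  move=> km mN; have mk : (m - k - 1 < N - k)%N by lia.
  rewrite (bigD1 (Ordinal mk))//= (_ : (k + (m - k - 1) + 1 = m)%N) ?subrr ?mul0r//.
  by lia.
rewrite big_ltn ?ltnS// [X in _ + X]big_nat_cond [X in _ + X]big1 ?addr0; last first.
  by move=> m /andP[/andP[nm mN] _]; rewrite vanish ?mul0r ?mulr0//; lia.
have [nk|nk] := eqVneq n k; last by rewrite vanish ?mul0r ?mulr0//; lia.
rewrite {n kn nN}nk /chelyshkov_coef subnn expr0 bin0 !mul1r.
have -> : \prod_(j < N - k) ((k + j + 1)%:R - k%:R) = (N - k)`!%:R :> F.
  rewrite -ffactnn -[in RHS](add0n (N - k)%N) ffactD_prod natr_prod.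
  by apply: eq_bigr => j _; rewrite !natrD; ring.
(* The product runs from [2k + 1] to [N + k + 1]; after its first factor it is the falling factorial
   that cancels the leading coefficient and [(N - k)!]. *)
have -> : \prod_(i < (N - k).+1) (k + k + 1 + i)%:R =
    (2 * k + 1)%:R * ('C(N + k + 1, N - k)%:R * (N - k)`!%:R) :> F.
  rewrite big_ord_recl -natrM bin_ffact.
  rewrite (_ : (N + k + 1 = 2 * k + 1 + (N - k))%N); last by lia.
  rewrite ffactD_prod natr_prod; congr (_%:R * _); first by rewrite /=; lia.
  by apply: eq_bigr => j _; congr (_%:R); rewrite /= /bump; lia.
field.
rewrite !pnatr_eq0 -!lt0n fact_gt0 bin_gt0 -natrM natr1 pnatr_eq0; lia.
Qed.

(** * The weighted inner product on bounded measurable functions *)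

Lemma Rintegral_sumZl d (T : measurableType d) (R : realType)
    (mu : {measure set T -> \bar R}) (D : set T) (I : Type) (s : seq I) (c : I -> R)
    (f : I -> T -> R) : measurable D ->
  (forall i, mu.-integrable D (EFin \o f i)) ->
  \int[mu]_(x in D) (\sum_(i <- s) c i * f i x) = \sum_(i <- s) c i * \int[mu]_(x in D) f i x.
Proof.
move=> mD If.
have IZ i : mu.-integrable D (fun x => (c i * f i x)%:E).
  by under eq_fun do rewrite EFinM; exact: (integrableZl mD (c i) (If i)).
have IS t : mu.-integrable D (fun x => (\sum_(i <- t) c i * f i x)%:E).
  by under eq_fun do rewrite -sumEFin; exact: integrable_sum.
elim: s => [|i s IH].
  by under eq_Rintegral do rewrite big_nil; rewrite big_nil /Rintegral integral0.
under eq_Rintegral do rewrite big_cons.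
by rewrite RintegralD ?big_cons ?RintegralZl ?IH//; [exact: IZ | exact: IS].
Qed.

(** A class closed under sums and products and integrable against the weight, so that every inner
    product below exists without Cauchy-Schwarz. *)
Definition bounded_measurable (R : realType) (f : R -> R) : Prop :=
  measurable_fun (`[0, 1]%classic : set R) f /\
  exists M : R, forall x, 0 <= x <= 1 -> `|f x| <= M.

Lemma eq_bounded_measurable (R : realType) (f g : R -> R) :
  (forall x, 0 <= x <= 1 -> f x = g x) -> bounded_measurable f -> bounded_measurable g.
Proof.
move=> fg [mf [M fM]]; split; last by exists M => x x01; rewrite -fg ?fM.
apply: eq_measurable_fun mf => x; rewrite inE/= in_itv/=; exact: fg.
Qed.

Lemma bounded_measurableD (R : realType) (f g : R -> R) :
  bounded_measurable f -> bounded_measurable g -> bounded_measurable (f \+ g).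
Proof.
move=> [mf [M fM]] [mg [K gK]]; split; first exact: measurable_funD.
by exists (M + K) => x x01; rewrite (le_trans (ler_normD _ _))// lerD ?fM ?gK.
Qed.

Lemma bounded_measurableM (R : realType) (f g : R -> R) :
  bounded_measurable f -> bounded_measurable g -> bounded_measurable (f \* g).
Proof.
move=> [mf [M fM]] [mg [K gK]]; split; first exact: measurable_funM.
by exists (M * K) => x x01; rewrite normrM ler_pM ?fM ?gK.
Qed.

Lemma bounded_measurable_cst (R : realType) (c : R) : bounded_measurable (fun=> c).
Proof. by split; [exact: measurable_cst | exists `|c|]. Qed.

Lemma bounded_measurable_sum (R : realType) (I : Type) (s : seq I) (f : I -> R -> R) :
  (forall i, bounded_measurable (f i)) ->
  bounded_measurable (fun x => \sum_(i <- s) f i x).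
Proof.
move=> bf; elim: s => [|i s IH].
  by apply: eq_bounded_measurable (bounded_measurable_cst 0) => x _; rewrite big_nil.
by apply: eq_bounded_measurable (bounded_measurableD (bf i) IH) => x _; rewrite big_cons.
Qed.

Lemma bounded_measurable_powR (R : realType) (e : R) : 0 <= e ->
  bounded_measurable (@powR R ^~ e).
Proof.
move=> e0; split; first by apply: measurable_funTS; exact: measurable_powR.
exists 1 => x /andP[x0 x1]; rewrite ger0_norm ?powR_ge0//.
by rewrite [leRHS](_ : 1 = 1 `^ e) ?ge0_ler_powR ?nnegrE ?powR1.
Qed.

Lemma bounded_measurableZ (R : realType) (c : R) (f : R -> R) :
  bounded_measurable f -> bounded_measurable (fun x => c * f x).
Proof. exact: (bounded_measurableM (bounded_measurable_cst c)). Qed.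

Lemma integrable_weight (R : realType) (nu : R) : 0 < nu ->
  lebesgue_measure.-integrable `[0, 1] (EFin \o weight nu).
Proof.
move=> nu0; apply/integrableP; split.
  by apply/measurable_EFinP; apply: measurable_funTS; exact: measurable_powR.
under eq_integral => x _ do rewrite /= ger0_norm ?powR_ge0//.
by rewrite integral_powR01// ltry.
Qed.

Lemma integrable_bounded_weight (R : realType) (nu : R) (f : R -> R) : 0 < nu ->
  bounded_measurable f ->
  lebesgue_measure.-integrable `[0, 1] (fun x => (f x * weight nu x)%:E).
Proof.
move=> nu0 [mf [M fM]].
have bf : [bounded f x | x in `[0, 1]%classic : set R].
  exists M; split; [exact: num_real | move=> K MK x /=]; rewrite in_itv/= => x01.
  by rewrite (le_trans (fM _ x01))// ltW.
exact: (@integrableMr _ (measurableTypeR R) _ _ _ (measurable_itv _) f _ mf bf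
  (integrable_weight nu0)).
Qed.

Lemma innerL2C (R : realType) (nu : R) (f g : R -> R) : innerL2 nu f g = innerL2 nu g f.
Proof. by apply: eq_Rintegral => x _; rewrite (mulrC (f x)). Qed.

Lemma eq_innerL2 (R : realType) (nu : R) (f f' g g' : R -> R) :
  (forall x, 0 <= x <= 1 -> f x = f' x) -> (forall x, 0 <= x <= 1 -> g x = g' x) ->
  innerL2 nu f g = innerL2 nu f' g'.
Proof.
move=> ff' gg'; apply: eq_Rintegral => x; rewrite inE/= in_itv/= => x01.
by rewrite ff'// gg'.
Qed.

Lemma innerL2_ge0 (R : realType) (nu : R) (f : R -> R) : 0 <= innerL2 nu f f.
Proof.
by apply: Rintegral_ge0 => x _; rewrite mulr_ge0 ?powR_ge0// -expr2 sqr_ge0.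
Qed.

Lemma innerL2Dl (R : realType) (nu : R) (f g h : R -> R) : 0 < nu ->
  bounded_measurable f -> bounded_measurable g -> bounded_measurable h ->
  innerL2 nu (f \+ g) h = innerL2 nu f h + innerL2 nu g h.
Proof.
move=> nu0 bf bg bh; rewrite -RintegralD//=.
- by apply: eq_Rintegral => x _; rewrite !mulrDl.
- exact: (integrable_bounded_weight nu0 (bounded_measurableM bf bh)).
- exact: (integrable_bounded_weight nu0 (bounded_measurableM bg bh)).
Qed.

Lemma innerL2_suml (R : realType) (nu : R) (I : Type) (s : seq I) (c : I -> R)
    (f : I -> R -> R) (h : R -> R) : 0 < nu ->
  (forall i, bounded_measurable (f i)) -> bounded_measurable h ->
  innerL2 nu (fun x => \sum_(i <- s) c i * f i x) h =
  \sum_(i <- s) c i * innerL2 nu (f i) h.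
Proof.
move=> nu0 bf bh; rewrite -Rintegral_sumZl//.
- by apply: eq_Rintegral => x _; rewrite !mulr_suml; apply: eq_bigr => i _; rewrite !mulrA.
- by move=> i; exact: (integrable_bounded_weight nu0 (bounded_measurableM (bf i) bh)).
Qed.

Lemma innerL2_powR (R : realType) (nu a b : R) : 0 < nu -> 0 <= a -> 0 <= b ->
  innerL2 nu (@powR R ^~ a) (@powR R ^~ b) = (a + b + nu)^-1.
Proof.
move=> nu0 a0 b0.
have abnu : 0 < a + b + nu by rewrite ltr_wpDl// addr_ge0.
have sub : `]0, 1]%classic `<=` (`[0, 1]%classic : set R) by exact: subset_itv_oc_cc.
rewrite /innerL2 -Rintegral_itv_obnd_cbnd; last first.
  apply: (@integrableS _ (measurableTypeR R) _ _ _ _ _ _ _ sub) => //.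
  apply: integrable_bounded_weight => //.
  by apply: bounded_measurableM; exact: bounded_measurable_powR.
transitivity (\int[lebesgue_measure]_(t in `]0, 1]) (t `^ (a + b + nu - 1)) : R).
  apply: eq_Rintegral => x; rewrite inE/= in_itv/= => /andP[x0 _].
  by rewrite /weight -!powRD ?addrA// (gt_eqF x0) implybT.
rewrite Rintegral_itv_obnd_cbnd; last first.
  by apply: (@integrableS _ (measurableTypeR R) _ _ _ _ _ _ _ sub) => //; exact: integrable_weight.
by rewrite /Rintegral integral_powR01.
Qed.

Lemma inL2_bounded (R : realType) (nu : R) (f : R -> R) : 0 < nu ->
  bounded_measurable f -> inL2 nu f.
Proof.
move=> nu0 bf; split; first by case: bf.
have /integrableP[_] := integrable_bounded_weight nu0 (bounded_measurableM bf bf).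
apply: le_lt_trans; rewrite le_eqVlt; apply/orP; left; apply/eqP.
apply: eq_integral => x _; rewrite /= real_normK ?num_real// expr2 ger0_norm//.
by rewrite mulr_ge0 ?powR_ge0// -expr2 sqr_ge0.
Qed.

(** The excess of a squared error over the minimum is a sum of squares of coefficient differences
    weighted by [h k > 0]. Uniqueness thus holds for coefficients, hence at every point of [0, 1]
    and not just almost everywhere. *)
Lemma best_approx_orthogonal (R : realType) N (nu : R) (h : 'I_N.+1 -> R) (u w : R -> R)
    (c : 'I_N.+1 -> R) : 0 < nu ->
  bounded_measurable u -> (forall k : 'I_N.+1, bounded_measurable (chelyshkov N nu k)) ->
  (forall k, 0 < h k) ->
  (forall n k : 'I_N.+1,
    innerL2 nu (chelyshkov N nu n) (chelyshkov N nu k) = (n == k)%:R * h k) ->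
  (forall k : 'I_N.+1, innerL2 nu u (chelyshkov N nu k) = c k * h k) ->
  (forall x, 0 <= x <= 1 -> w x = \sum_(k < N.+1) c k * chelyshkov N nu k x) ->
  best_approx N nu u w.
Proof.
move=> nu0 bu bC h0 CC uC wE.
pose P (d : 'I_N.+1 -> R) x := \sum_(k < N.+1) d k * chelyshkov N nu k x.
have bP d : bounded_measurable (P d).
  by apply: bounded_measurable_sum => k; exact: bounded_measurableZ.
(* The residual, written as a sum so that additivity of the inner product applies directly. *)
pose r x := u x + P (fun k => - c k) x.
have br : bounded_measurable r by exact: bounded_measurableD.
have PC d (k : 'I_N.+1) : innerL2 nu (P d) (chelyshkov N nu k) = d k * h k.
  rewrite innerL2_suml// (bigD1 k)//= CC eqxx mul1r big1 ?addr0// => i ik.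
  by rewrite CC (negbTE ik) mul0r mulr0.
have rC (k : 'I_N.+1) : innerL2 nu r (chelyshkov N nu k) = 0.
  by rewrite innerL2Dl// PC uC mulNr subrr.
have rP d : innerL2 nu (P d) r = 0.
  by rewrite innerL2_suml// big1// => k _; rewrite innerL2C rC mulr0.
have PP d : innerL2 nu (P d) (P d) = \sum_(k < N.+1) d k ^+ 2 * h k.
  rewrite innerL2_suml//; apply: eq_bigr => k _.
  by rewrite innerL2C PC mulrA expr2.
have pythagoras v e : (forall x, 0 <= x <= 1 -> v x = P e x) ->
    innerL2 nu (u \- v) (u \- v) = innerL2 nu r r + \sum_(k < N.+1) (c k - e k) ^+ 2 * h k.
  move=> ve; pose d k := c k - e k.
  have uv x : 0 <= x <= 1 -> (u \- v) x = (r \+ P d) x.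
    move=> x01; rewrite /= ve// /r /P -addrA -big_split/= -sumrN; congr (_ + _).
    by apply: eq_bigr => k _; rewrite /d; ring.
  rewrite (eq_innerL2 _ uv uv) (@innerL2Dl _ _ r (P d))//; last exact: bounded_measurableD.
  rewrite innerL2C [X in _ + X]innerL2C !(@innerL2Dl _ _ r (P d))// rP (innerL2C _ r) rP.
  by rewrite addr0 add0r PP.
have minE v e : (forall x, 0 <= x <= 1 -> v x = P e x) ->
    innerL2 nu (u \- w) (u \- w) <= innerL2 nu (u \- v) (u \- v).
  move=> ve; rewrite (pythagoras _ _ wE) (pythagoras _ _ ve) lerD2l.
  rewrite big1 => [|k _]; last by rewrite subrr expr0n mul0r.
  by apply: sumr_ge0 => k _; rewrite mulr_ge0 ?sqr_ge0// ltW.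
split; first exact: inL2_bounded.
- split; first by exists c.
  by move=> v [e ve]; apply: ler_wsqrtr; exact: (minE _ e).
- move=> v [[e ve] /(_ w)]; rewrite ler_sqrt ?innerL2_ge0// => vw x x01.
  (* A second minimizer [v] is compared with [w] itself, which forces the weighted sum of squares to
     be at most 0. *)
  move: (vw (ex_intro _ c wE)).
  rewrite (pythagoras _ _ wE) (pythagoras _ _ ve) lerD2l [leRHS]big1 => [|k _]; last first.
    by rewrite subrr expr0n mul0r.
  move=> le0.
  have t0 k : true -> 0 <= (c k - e k) ^+ 2 * h k by rewrite mulr_ge0 ?sqr_ge0// ltW.
  have /eqP : \sum_(k < N.+1) (c k - e k) ^+ 2 * h k = 0.
    by apply/eqP; rewrite eq_le le0 sumr_ge0.
  rewrite psumr_eq0// => /allP ce.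
  rewrite ve// wE//; apply: eq_bigr => k _; congr (_ * _).
  have := ce k (mem_index_enum _); rewrite /= mulf_eq0 (gt_eqF (h0 k)) orbF.
  by rewrite sqrf_eq0 subr_eq0 => /eqP.
Qed.

(** * The Abel integral and the Chelyshkov polynomials *)

Lemma measurable_powR_subr (R : realType) (D : set R) (c e : R) :
  measurable_fun D (fun s : R => (c - s) `^ e).
Proof.
apply: measurable_funTS.
apply: (@measurableT_comp _ _ _ _ _ _ (@powR R ^~ e) _ (fun s : R => c - s) (measurable_powR e)).
exact: measurable_funB.
Qed.

(** On [0, 1] the factor [(1 - t)]^ b[is at most 1, so]t [^ (a - 1)] dominates. *)
Lemma integrable_beta (R : realType) (a b : R) : 0 < a -> 0 <= b ->
  lebesgue_measure.-integrable `[0, 1] (fun t : R => (t `^ (a - 1) * (1 - t) `^ b)%:E).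
Proof.
move=> a0 b0.
have := integrable_weight a0.
apply: le_integrable => //.
  apply/measurable_EFinP; apply: measurable_funM.
    by apply: measurable_funTS; exact: measurable_powR.
  exact: measurable_powR_subr.
move=> t /=; rewrite in_itv/= => /andP[t0 t1]; rewrite lee_fin.
rewrite ger0_norm ?mulr_ge0 ?powR_ge0// ger0_norm ?powR_ge0//.
rewrite ler_piMr ?powR_ge0//.
by rewrite [leRHS](_ : 1 = 1 `^ b) ?ge0_ler_powR ?nnegrE ?powR1//; lra.
Qed.

Lemma abel_integral_powR (R : realType) (a b x : R) : 0 < a -> 0 <= b -> 0 < x ->
  (\int[lebesgue_measure]_(s in `[0%R, x]) ((x - s) `^ (a - 1) * s `^ b)%:E =
   (Beta a (b + 1) * x `^ (a + b))%:E)%E.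
Proof.
move=> a0 b0 x0.
rewrite (@ge0_integral_affine R x (fun s => (x - s) `^ (a - 1) * s `^ b))//; last 2 first.
- apply: measurable_funM.
    exact: measurable_powR_subr.
  by apply: measurable_funTS; exact: measurable_powR.
- by move=> s; rewrite mulr_ge0 ?powR_ge0.
transitivity (x%:E * \int[lebesgue_measure]_(t in `[0%R, 1%R])
    ((x `^ (a - 1 + b))%:E * (t `^ (a - 1) * (1 - t) `^ b)%:E))%E.
  congr (_ * _)%E; apply: eq_integral => t; rewrite inE/= in_itv/= => /andP[t0 t1].
  rewrite -EFinM; congr (_%:E).
  rewrite (_ : x - (x - x * t) = x * t); last by ring.
  rewrite (_ : x - x * t = x * (1 - t)); last by ring.
  rewrite !powRM ?subr_ge0 ?(ltW x0)// (@powRD _ x (a - 1) b) ?(gt_eqF x0) ?implybT//; ring.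
rewrite integralZl//; last exact: integrable_beta.
rewrite muleA -EFinM -[x in (x * _)%:E]powRr1 ?(ltW x0)//.
rewrite -powRD ?(gt_eqF x0) ?implybT// /Beta addrK.
rewrite (_ : 1 + (a - 1 + b) = a + b); last by ring.
rewrite [RHS]EFinM muleC; congr (_ * _)%E.
by rewrite fineK//; apply: integrable_fin_num => //; exact: integrable_beta.
Qed.

Lemma integrable_abel (R : realType) (a b x : R) : 0 < a -> 0 <= b -> 0 < x ->
  lebesgue_measure.-integrable `[0, x] (fun s : R => ((x - s) `^ (a - 1) * s `^ b)%:E).
Proof.
move=> a0 b0 x0; apply/integrableP; split.
  apply/measurable_EFinP; apply: measurable_funM.
    exact: measurable_powR_subr.
  by apply: measurable_funTS; exact: measurable_powR.
under eq_integral => s _ do rewrite /= ger0_norm ?mulr_ge0 ?powR_ge0//.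
by rewrite abel_integral_powR// ltry.
Qed.

Lemma chelyshkovE (R : realType) N (nu : R) n x : chelyshkov N nu n x =
  \sum_(n <= j < N.+1) chelyshkov_coef R N n j * x `^ (j%:R * nu).
Proof. by []. Qed.

Lemma abel_integral_chelyshkov (R : realType) N (nu a : R) n x : 0 < nu -> 0 < a -> 0 <= x ->
  \int[lebesgue_measure]_(s in `[0, x]) ((x - s) `^ (a - 1) * chelyshkov N nu n s) =
  \sum_(n <= j < N.+1) (chelyshkov_coef R N n j * Beta a (j%:R * nu + 1)) * x `^ (a + j%:R * nu).
Proof.
move=> nu0 a0; have jnu j : 0 <= j%:R * nu by rewrite mulr_ge0// ltW.
(* At [x = 0] the integral is over a point, and the right-hand side vanishes because the exponents
   [a + j nu] are positive. *)
rewrite le_eqVlt => /predU1P[<-|x0].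
  rewrite set_itv1 Rintegral_set1 big1// => j _.
  by rewrite powR0 ?mulr0// gt_eqF// ltr_wpDr.
transitivity (\int[lebesgue_measure]_(s in `[0, x])
    (\sum_(n <= j < N.+1) chelyshkov_coef R N n j * ((x - s) `^ (a - 1) * s `^ (j%:R * nu)))).
  by apply: eq_Rintegral => s _; rewrite chelyshkovE mulr_sumr; apply: eq_bigr => j _; rewrite mulrCA.
rewrite Rintegral_sumZl//; last by move=> j; exact: integrable_abel.
by apply: eq_bigr => j _; rewrite /Rintegral abel_integral_powR// mulrA.
Qed.

Lemma bounded_measurable_chelyshkov (R : realType) N (nu : R) n : 0 < nu ->
  bounded_measurable (chelyshkov N nu n).
Proof.
move=> nu0; apply: bounded_measurable_sum => j; apply: bounded_measurableZ.
by apply: bounded_measurable_powR; rewrite mulr_ge0// ltW.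
Qed.

(** Used with exponent [m nu] for orthogonality and with [alpha + j nu] for the entries of the
    matrix. *)
Lemma innerL2_powR_chelyshkov (R : realType) N (nu a : R) k : 0 < nu -> 0 <= a ->
  innerL2 nu (@powR R ^~ a) (chelyshkov N nu k) =
  \sum_(k <= l < N.+1) chelyshkov_coef R N k l / (a + l%:R * nu + nu).
Proof.
move=> nu0 a0; have jnu j : 0 <= j%:R * nu by rewrite mulr_ge0// ltW.
rewrite innerL2C innerL2_suml//; last 2 first.
- by move=> l; exact: bounded_measurable_powR.
- exact: bounded_measurable_powR.
by apply: eq_bigr => l _; rewrite innerL2C innerL2_powR.
Qed.

Lemma innerL2_chelyshkov (R : realType) N (nu : R) (n k : 'I_N.+1) : 0 < nu ->
  innerL2 nu (chelyshkov N nu n) (chelyshkov N nu k) =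
  (n == k)%:R * (nu * (2 * k + 1)%:R)^-1.
Proof.
move=> nu0; have jnu j : 0 <= j%:R * nu by rewrite mulr_ge0// ltW.
(* The algebraic identity covers [k <= n]; symmetry of the inner product gives the rest. *)
wlog kn : n k / (k <= n)%N.
  move=> H; have [|/ltnW] := leqP k n; first exact: H.
  move=> /H; rewrite innerL2C eq_sym => ->.
  by have [->|] := eqVneq k n; rewrite ?mul0r.
rewrite innerL2_suml//; last 2 first.
- by move=> l; exact: bounded_measurable_powR.
- exact: bounded_measurable_chelyshkov.
have := @chelyshkov_coef_orthogonal R N k n.
rewrite kn -ltnS ltn_ord => /(_ isT) /(congr1 ( *%R nu^-1)).
rewrite mulr_sumr invfM mulrCA (inj_eq val_inj) => <-; apply: eq_bigr => m _.
rewrite innerL2_powR_chelyshkov// !mulr_sumr; apply: eq_bigr => l _.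
rewrite (_ : m%:R * nu + l%:R * nu + nu = nu * (m + l + 1)%:R); last by rewrite !natrD; ring.
rewrite invfM -/(chelyshkov_coef R N n m); ring.
Qed.

(** Exhibits [xi] as the Fourier coefficient of [x^(a + j nu)] on the [k]-th polynomial: the sum is
    the inner product, the prefactor the inverse squared norm. *)
Lemma xiE (R : realType) N (nu a : R) k j : xi N nu a k j =
  nu * (2 * k + 1)%:R *
  \sum_(k <= l < N.+1) chelyshkov_coef R N k l / (a + j%:R * nu + l%:R * nu + nu).
Proof.
congr (_ * _); apply: eq_bigr => l _; rewrite /chelyshkov_coef.
rewrite (_ : a + _ + _ + _ = (j + l + 1)%:R * nu + a); last by rewrite !natrD; ring.
by rewrite -!mulrA; congr (_ * _); rewrite mulrC -mulrA.
Qed.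

Theorem theorem1 (R : realType) (N : nat) (nu alpha : R)
    (nu_gt0 : 0 < nu) (nu_lt1 : nu < 1)
    (alpha_gt0 : 0 < alpha) (alpha_lt1 : alpha < 1) :
  forall n : 'I_N.+1,
    best_approx N nu
      (fun x : R => abel_integral_vec alpha (chelyshkov_vec N nu) x n ord0)
      (fun x : R => (op_matrix N nu alpha *m chelyshkov_vec N nu x) n ord0).
Proof.
move=> n.
have e0 j : 0 <= alpha + j%:R * nu by rewrite addr_ge0 ?mulr_ge0// ltW.
set u := (fun x => abel_integral_vec _ _ _ _ _).
pose c j := chelyshkov_coef R N n j * Beta alpha (j%:R * nu + 1).
pose v x := \sum_(n <= j < N.+1) c j * x `^ (alpha + j%:R * nu).
(* All exponents in [v] are nonnegative, so this equality makes the Abel integral bounded and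
   measurable on [0, 1]. *)
have uv x : 0 <= x <= 1 -> u x = v x.
  move=> /andP[x0 _]; apply: etrans (abel_integral_chelyshkov N n nu_gt0 alpha_gt0 x0).
  rewrite /u mxE.
  by apply: eq_Rintegral => s _; rewrite mxE.
have bv : bounded_measurable v.
  by apply: bounded_measurable_sum => j; apply/bounded_measurableZ/bounded_measurable_powR.
apply: (@best_approx_orthogonal _ _ _ (fun k => (nu * (2 * k + 1)%:R)^-1) _ _
  (fun k => Theta N nu alpha n k)) => //.
- by apply: eq_bounded_measurable bv => x x01; rewrite uv.
- by move=> k; exact: bounded_measurable_chelyshkov.
- by move=> k; rewrite invr_gt0 mulr_gt0// ltr0n addn1.
- by move=> *; exact: innerL2_chelyshkov.
- move=> k; rewrite (eq_innerL2 _ uv (fun x _ => erefl)) innerL2_suml//; last 2 first.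
  + by move=> j; exact: bounded_measurable_powR.
  + exact: bounded_measurable_chelyshkov.
  (* The prefactor of [xi] cancels the squared norm term by term in [j]. *)
  have k0 : nu * (2 * k + 1)%:R != 0 by rewrite mulf_neq0 ?(gt_eqF nu_gt0) ?pnatr_eq0 ?addn1.
  rewrite /Theta mulr_suml; apply: eq_bigr => j _.
  rewrite innerL2_powR_chelyshkov// xiE -/(chelyshkov_coef R N n j) -/(c j).
  by rewrite -[RHS]mulrA [X in _ = _ * X]mulrAC mulfV// mul1r.
- by move=> x _; rewrite mxE; apply: eq_bigr => k _; rewrite !mxE.
Qed.
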